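(* Let $G$ be a finite group and $T$ a $G$-Tambara functor. Let $\mathrm{RadId}_G(T)$ be the frame of radical Tambara ideals of $T$ (ordered by inclusion). Then there is a canonical homeomorphism \[ \mathrm{pt}\bigl(\mathrm{RadId}_G(T)\bigr)\cong \operatorname{Spec}_{\mathbf{Nak}}(T) \] under which, for each $I\in \mathrm{RadId}_G(T)$, the basic open $U(I)=\{p\mid p(I)=1\}$ corresponds to $\{P\in \operatorname{Spec}_{\mathbf{Nak}}(T)\mid I\not\subseteq P\}$.
   Context: All rings are commutative with unit. A $G$-Tambara functor $T$ consists of commutative rings $T(G/H)$ for each subgroup $H\le G$, ring homomorphisms (restrictions) $r^H_K\colon T(G/H)\to T(G/K)$, additive maps (transfers) $t^H_K\colon T(G/K)\to T(G/H)$ and multiplicative maps (norms) $N^H_K\colon T(G/K)\to T(G/H)$ for $K\le H$, and ring isomorphisms (conjugations) $c_{g,H}\colon T(G/H)\to T(G/gHg^{-1})$, satisfying the standard axioms (functoriality, conjugation compatibility, additive and multiplicative double coset formulas, Frobenius reciprocity, Tambara reciprocity), as in Hill–Mazur. A (Tambara) ideal $I\trianglelefteq T$ is a family of ring ideals $I(G/H)\subseteq T(G/H)$ with $r^H_K(I(G/H))\subseteq I(G/K)$, $t^H_K(I(G/K))\subseteq I(G/H)$, $N^H_K(I(G/K))\subseteq I(G/H)$ for all $K\le H$, and $c_{g,H}(I(G/H))=I(G/gHg^{-1})$; it is proper if $1\notin I(G/G)$. Intersections and levelwise sums of Tambara ideals are Tambara ideals; $\langle X\rangle$ denotes the smallest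 Tambara ideal containing a given set $X$ of elements (each at a specified level), and $\langle x\rangle$ for $x\in T(G/H)$ the one generated by $x$. The product $IJ$ of Tambara ideals is the Tambara ideal generated by the levelwise products $I(G/H)\cdot J(G/H)$, $H\le G$. The radical $\sqrt{I}$ is the Tambara ideal with $\sqrt{I}(G/H)=\{x\in T(G/H)\mid \langle x\rangle^n\subseteq I \text{ for some } n\ge 1\}$; $I$ is radical if $I=\sqrt I$. A proper ideal $P$ is prime if for all Tambara ideals $I,J$, $IJ\subseteq P$ implies $I\subseteq P$ or $J\subseteq P$. $\operatorname{Spec}_{\mathbf{Nak}}(T)$ is the set of prime Tambara ideals, topologized by taking the sets $V_H(x)=\{P\mid x\in P(G/H)\}$ ($H\le G$, $x\in T(G/H)$) as a subbasis of closed sets. $\mathrm{RadId}_G(T)$ is the set of radical Tambara ideals ordered by inclusion; it is a frame (complete lattice in which finite meets distribute over arbitrary joins), with meets intersections and joins $\bigvee_\lambda I_\lambda=\sqrt{\sum_\lambda I_\lambda}$. For a frame $A$, a point is a map $p\colon A\to\{0<1\}$ preserving arbitrary joins and finite meets (including the top element); $\mathrm{pt}(A)$ is the set of points with the topology whose basic opens are $U(a)=\{p\mid p(a)=1\}$, $a\in A$. *)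

(* Defs.v *)
From HB Require Import structures.
From mathcomp Require Import all_boot all_order all_algebra all_fingroup.


Import GRing.Theory.
Local Open Scope ring_scope.

(* The finite group G is the whole finGroupType gT; subgroups H <= G are the
   groups H : {group gT}.  The level T(G/H) is the commutative ring [tR T H].
   Maps are total functions; the axioms only constrain them where the paper
   defines them (K \subset H, resp. K = g H g^-1).
   tres H K  : T(G/H) -> T(G/K)   restriction  r^H_K
   ttr  H K  : T(G/K) -> T(G/H)   transfer     t^H_K
   tnm  H K  : T(G/K) -> T(G/H)   norm         N^H_K
   tcj g H K : T(G/H) -> T(G/K)   conjugation  c_{g,H}, for K = g H g^-1
   (in MathComp, H :^ x = x^-1 H x, so g H g^-1 = H :^ g^-1). *)
Record tdata (gT : finGroupType) := TData {
  tR : {group gT} -> comPzRingType;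
  tres : forall H K : {group gT}, tR H -> tR K;
  ttr : forall H K : {group gT}, tR K -> tR H;
  tnm : forall H K : {group gT}, tR K -> tR H;
  tcj : forall (g : gT) (H K : {group gT}), tR H -> tR K
}.
Arguments tR {gT} t H.
Arguments tres {gT} t H K _.
Arguments ttr {gT} t H K _.
Arguments tnm {gT} t H K _.
Arguments tcj {gT} t g H K _.

Definition ringhom {R1 R2 : comPzRingType} (f : R1 -> R2) :=
  [/\ forall x y, f (x + y) = f x + f y,
      forall x y, f (x * y) = f x * f y & f 1 = 1].

Section Tambara.
Variable gT : finGroupType.

Definition dcosets (K L H : {set gT}) : {set {set gT}} :=
  [set ((K :* g) * L)%g | g in H].

Definition lact (h : gT) (U : {set {set gT}}) : {set {set gT}} :=
  [set lcoset C h | C in U].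

Definition subset_orbits (K H : {set gT}) : {set {set {set {set gT}}}} :=
  [set [set lact h U | h in H] | U in powerset (lcosets K H)].

(* sections of H/L -> H/K (L <= K <= H), encoded as a set S of L-cosets
   containing exactly one L-coset inside each K-coset *)
Definition sections (L K H : {set gT}) : {set {set {set gT}}} :=
  [set S in powerset (lcosets L H) |
     [forall C in lcosets K H, #|[set D in S | D \subset C]| == 1%N]].

Definition section_orbits (L K H : {set gT}) : {set {set {set {set gT}}}} :=
  [set [set lact h S | h in H] | S in sections L K H].

(* stabilizer in H of U (it is a group, so <<.>> does not change it) *)
Definition stab_grp (H : {set gT}) (U : {set {set gT}}) : {group gT} :=
  (<<[set h in H | lact h U == U]>>)%G.

Definition coset_orbits (S K H : {set gT}) : {set {set {set gT}}} :=
  [set [set lcoset C s | s in S] | C in lcosets K H].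

Variable T : tdata gT.
Local Notation R := (tR T).
Local Notation rs := (@tres gT T).
Local Notation tf := (@ttr gT T).
Local Notation nm := (@tnm gT T).
Local Notation cj := (@tcj gT T).

Definition dc_tr_rhs (H K L : {group gT}) (x : R L) : R K :=
  \sum_(D in dcosets K L H)
     tf K (K :&: L :^ (repr D)^-1)%G
        (cj (repr D) ((K :^ repr D) :&: L)%G (K :&: L :^ (repr D)^-1)%G
            (rs L ((K :^ repr D) :&: L)%G x)).

Definition dc_nm_rhs (H K L : {group gT}) (x : R L) : R K :=
  \prod_(D in dcosets K L H)
     nm K (K :&: L :^ (repr D)^-1)%G
        (cj (repr D) ((K :^ repr D) :&: L)%G (K :&: L :^ (repr D)^-1)%G
            (rs L ((K :^ repr D) :&: L)%G x)).

(* Tambara reciprocity for sums: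
   N^H_K(a+b) = sum_{[U] in P(H/K)/H} t^H_{H_U}( prod_{H_U-orbits of gK}
      N^{H_U}_{H_U cap gKg^-1} r^{gKg^-1}_{H_U cap gKg^-1} c_{g,K}(a or b) ),
   with a if gK in U, b otherwise. *)
Definition recip_sum_rhs (H K : {group gT}) (a b : R K) : R H :=
  \sum_(O in subset_orbits K H)
    tf H (stab_grp H (odflt set0 [pick U in O]))
      (\prod_(w in coset_orbits (stab_grp H (odflt set0 [pick U in O])) K H)
        nm (stab_grp H (odflt set0 [pick U in O]))
           (stab_grp H (odflt set0 [pick U in O])
              :&: K :^ (repr (odflt set0 [pick C in w]))^-1)%G
           (rs (K :^ (repr (odflt set0 [pick C in w]))^-1)%G
                (stab_grp H (odflt set0 [pick U in O])
                   :&: K :^ (repr (odflt set0 [pick C in w]))^-1)%G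
                (cj (repr (odflt set0 [pick C in w])) K
                    (K :^ (repr (odflt set0 [pick C in w]))^-1)%G
                    (if odflt set0 [pick C in w] \in odflt set0 [pick U in O]
                     then a else b)))).

(* Tambara reciprocity for norms of transfers (L <= K <= H):
   N^H_K t^K_L(a) = sum_{[s] in Sec(H/L -> H/K)/H} t^H_{H_s}( prod_{H_s-orbits of C in H/K}
      N^{H_s}_{H_s cap g K g^-1} r^{gLg^-1}_{H_s cap gKg^-1} c_{g,L}(a) ),
   where gL = s(C). *)
Definition recip_tr_rhs (H K L : {group gT}) (a : R L) : R H :=
  \sum_(O in section_orbits L K H)
    tf H (stab_grp H (odflt set0 [pick S in O]))
      (\prod_(w in coset_orbits (stab_grp H (odflt set0 [pick S in O])) K H)
        nm (stab_grp H (odflt set0 [pick S in O]))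
           (stab_grp H (odflt set0 [pick S in O]) :&: K :^
              (repr (odflt set0 [pick D in odflt set0 [pick S in O]
                                   | D \subset odflt set0 [pick C in w]]))^-1)%G
           (rs (L :^ (repr (odflt set0 [pick D in odflt set0 [pick S in O]
                                   | D \subset odflt set0 [pick C in w]]))^-1)%G
                (stab_grp H (odflt set0 [pick S in O]) :&: K :^
                  (repr (odflt set0 [pick D in odflt set0 [pick S in O]
                                   | D \subset odflt set0 [pick C in w]]))^-1)%G
                (cj (repr (odflt set0 [pick D in odflt set0 [pick S in O]
                                   | D \subset odflt set0 [pick C in w]])) L
                    (L :^ (repr (odflt set0 [pick D in odflt set0 [pick S in O]
                                   | D \subset odflt set0 [pick C in w]]))^-1)%G
                    a))).

Record is_tambara : Prop := {
  res_rmorph : forall H K : {group gT}, K \subset H -> ringhom (rs H K);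
  tr_add : forall (H K : {group gT}) (x y : R K), K \subset H ->
     tf H K (x + y) = tf H K x + tf H K y;
  nm_mul : forall (H K : {group gT}) (x y : R K), K \subset H ->
     nm H K (x * y) = nm H K x * nm H K y;
  nm_one : forall H K : {group gT}, K \subset H -> nm H K 1 = 1;
  cj_rmorph : forall (g : gT) (H K : {group gT}), (K :=: H :^ g^-1)%g ->
     ringhom (cj g H K);
  cj_comp : forall (g g' : gT) (H K L : {group gT}) (x : R H),
     (K :=: H :^ g^-1)%g -> (L :=: K :^ g'^-1)%g ->
     cj g' K L (cj g H K x) = cj (g' * g)%g H L x;
  cj_inner : forall (h : gT) (H : {group gT}) (x : R H), h \in H -> cj h H H x = x;
  res_id : forall (H : {group gT}) (x : R H), rs H H x = x;
  res_comp : forall (H K L : {group gT}) (x : R H), L \subset K -> K \subset H ->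
     rs K L (rs H K x) = rs H L x;
  tr_id : forall (H : {group gT}) (x : R H), tf H H x = x;
  tr_comp : forall (H K L : {group gT}) (x : R L), L \subset K -> K \subset H ->
     tf H K (tf K L x) = tf H L x;
  nm_id : forall (H : {group gT}) (x : R H), nm H H x = x;
  nm_comp : forall (H K L : {group gT}) (x : R L), L \subset K -> K \subset H ->
     nm H K (nm K L x) = nm H L x;
  cj_res : forall (g : gT) (H K H' K' : {group gT}) (x : R H), K \subset H ->
     (H' :=: H :^ g^-1)%g -> (K' :=: K :^ g^-1)%g ->
     cj g K K' (rs H K x) = rs H' K' (cj g H H' x);
  cj_tr : forall (g : gT) (H K H' K' : {group gT}) (x : R K), K \subset H ->
     (H' :=: H :^ g^-1)%g -> (K' :=: K :^ g^-1)%g ->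
     cj g H H' (tf H K x) = tf H' K' (cj g K K' x);
  cj_nm : forall (g : gT) (H K H' K' : {group gT}) (x : R K), K \subset H ->
     (H' :=: H :^ g^-1)%g -> (K' :=: K :^ g^-1)%g ->
     cj g H H' (nm H K x) = nm H' K' (cj g K K' x);
  double_coset_tr : forall (H K L : {group gT}) (x : R L), K \subset H -> L \subset H ->
     rs H K (tf H L x) = dc_tr_rhs H K L x;
  double_coset_nm : forall (H K L : {group gT}) (x : R L), K \subset H -> L \subset H ->
     rs H K (nm H L x) = dc_nm_rhs H K L x;
  frobenius : forall (H K : {group gT}) (a : R K) (b : R H), K \subset H ->
     tf H K (a * rs H K b) = tf H K a * b;
  tambara_sum : forall (H K : {group gT}) (a b : R K), K \subset H ->
     nm H K (a + b) = recip_sum_rhs H K a b;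
  tambara_tr : forall (H K L : {group gT}) (a : R L), L \subset K -> K \subset H ->
     nm H K (tf K L a) = recip_tr_rhs H K L a
}.

Definition tpred := forall H : {group gT}, R H -> Prop.

Definition tsub (A B : tpred) := forall H x, A H x -> B H x.
Definition teq (A B : tpred) := forall H x, A H x <-> B H x.

Definition is_ideal (I : tpred) : Prop :=
  (forall H, I H 0) /\
  (forall H x y, I H x -> I H y -> I H (x + y)) /\
  (forall H x y, I H y -> I H (x * y)) /\
  (forall (H K : {group gT}) x, K \subset H -> I H x -> I K (rs H K x)) /\
  (forall (H K : {group gT}) x, K \subset H -> I K x -> I H (tf H K x)) /\
  (forall (H K : {group gT}) x, K \subset H -> I K x -> I H (nm H K x)) /\
  (forall (g : gT) (H K : {group gT}), (K :=: H :^ g^-1)%g ->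
     forall y, I K y <-> exists2 x, I H x & y = cj g H K x).

Definition gen (X : tpred) : tpred :=
  fun H x => forall J, is_ideal J -> tsub X J -> J H x.

Definition gen1 (H0 : {group gT}) (x0 : R H0) : tpred :=
  fun H x => forall J, is_ideal J -> J H0 x0 -> J H x.

Definition lprod (I J : tpred) : tpred :=
  fun H z => exists n (a b : 'I_n -> R H),
    [/\ forall i, I H (a i), forall i, J H (b i) & z = \sum_(i < n) a i * b i].

Definition iprod (I J : tpred) : tpred := gen (lprod I J).

(* I^n for n >= 1, I^1 = I, I^(n+1) = I^n I *)
Definition ipow (I : tpred) (n : nat) : tpred := iter n.-1 (fun J => iprod J I) I.

Definition isqrt (I : tpred) : tpred :=
  fun H x => exists n, (0 < n)%N /\ tsub (ipow (gen1 H x) n) I.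

Definition is_radical (I : tpred) := teq I (isqrt I).

Definition isum (S : tpred -> Prop) : tpred :=
  fun H z => exists n (I : 'I_n -> tpred) (a : 'I_n -> R H),
    [/\ forall i, S (I i), forall i, I i H (a i) & z = \sum_(i < n) a i].

Definition is_prime (P : tpred) : Prop :=
  [/\ is_ideal P, ~ P [set: gT]%G 1 &
      forall I J, is_ideal I -> is_ideal J -> tsub (iprod I J) P ->
        tsub I P \/ tsub J P].

Definition radid := {I : tpred | is_ideal I /\ is_radical I}.

(* p preserves arbitrary joins (join = sqrt of the sum), binary meets
   (intersections) and the top element (the whole T); joins/meets are
   identified through their underlying families of subsets. *)
Definition is_point (p : radid -> bool) : Prop :=
  [/\ forall (S : radid -> Prop) (J : radid),
        teq (sval J) (isqrt (isum (fun I => exists2 K, S K & I = sval K))) ->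
        (p J <-> exists2 K, S K & p K),
      forall I J K : radid,
        teq (sval K) (fun H x => sval I H x /\ sval J H x) -> p K = p I && p J
    & forall K : radid, teq (sval K) (fun _ _ => True) -> p K].

Definition pt := {p : radid -> bool | is_point p}.

Definition spec := {P : tpred | is_prime P}.

End Tambara.
Arguments is_tambara {gT} T.
Arguments tpred {gT} T.
Arguments tsub {gT T} A B.
Arguments teq {gT T} A B.
Arguments is_ideal {gT T} I.
Arguments gen {gT T} X _ _.
Arguments gen1 {gT T} H0 x0 _ _.
Arguments lprod {gT T} I J _ _.
Arguments iprod {gT T} I J _ _.
Arguments ipow {gT T} I n _ _.
Arguments isqrt {gT T} I _ _.
Arguments is_radical {gT T} I.
Arguments isum {gT T} S _ _.
Arguments is_prime {gT T} P.
Arguments radid {gT} T.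
Arguments is_point {gT T} p.
Arguments pt {gT} T.
Arguments spec {gT} T.

Definition is_topology {X : Type} (O : (X -> Prop) -> Prop) : Prop :=
  [/\ O (fun _ => True),
      forall U V, O U -> O V -> O (fun x => U x /\ V x)
    & forall F : (X -> Prop) -> Prop, (forall U, F U -> O U) ->
        O (fun x => exists2 U, F U & U x)].

Definition gen_open {X : Type} (B : (X -> Prop) -> Prop) (U : X -> Prop) : Prop :=
  forall O, is_topology O -> (forall V, B V -> O V) -> O U.

Definition tcontinuous {X Y : Type} (OX : (X -> Prop) -> Prop)
  (OY : (Y -> Prop) -> Prop) (f : X -> Y) : Prop :=
  forall U, OY U -> OX (fun x => U (f x)).

Definition pt_open {gT : finGroupType} (T : tdata gT) : (pt T -> Prop) -> Prop :=
  gen_open (fun V => exists a : radid T, V = fun p => sval p a = true).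

Definition spec_open {gT : finGroupType} (T : tdata gT) : (spec T -> Prop) -> Prop :=
  gen_open (fun V => exists (H : {group gT}) (x : tR T H),
                       V = fun P => ~ sval P H x).

(* Main.v *)
(* A Tambara ideal P is recovered from the radical ideals it contains, so P
   corresponds to the point I |-> [I not contained in P], and a point p to the
   largest radical ideal on which it vanishes.  This needs that sqrt I is a
   radical ideal.  Call a family of subsets of the levels absorbing if it
   contains 0 and is stable under multiplication by ring elements,
   restrictions, norms and conjugations.  By the double coset formulas,
   Frobenius and Tambara reciprocity, the sums of transfers from an absorbing
   family form an ideal.  This computes <x> (from the multiples of the
   N^K_M r c_g x), products (from the products ab), and sums of ideals (from
   unions).  In particular <x>^n consists of sums of transfers of multiples of
   n-fold products of elements N^K_M r c_g x; at each level there are finitely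
   many of these, and their n-th powers are in I if x^n is.  Hence sqrt I is the
   levelwise radical. *)
Require Import Defs.
From HB Require Import structures.
From mathcomp Require Import all_boot all_order all_algebra all_fingroup.
From mathcomp Require Import boolp.
Import GRing.Theory.
Local Open Scope ring_scope.

Section TambaraIdeals.
Set Implicit Arguments.
Unset Strict Implicit.
Unset Printing Implicit Defensive.
Variables (gT : finGroupType) (T : tdata gT).
Hypothesis hT : is_tambara T.
Local Notation R := (tR T).
Local Notation rs := (tres T).
Local Notation tf := (ttr T).
Local Notation nm := (tnm T).
Local Notation cj := (tcj T).
Implicit Types (H K L M : {group gT}) (F A B I J P : tpred T).

Lemma ringhom0 (R1 R2 : comPzRingType) (f : R1 -> R2) : ringhom f -> f 0 = 0.
Proof. by case=> fD _ _; apply: (@addrI _ (f 0)); rewrite -fD !addr0. Qed.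

Lemma ringhomX (R1 R2 : comPzRingType) (f : R1 -> R2) x n :
  ringhom f -> f (x ^+ n) = f x ^+ n.
Proof.
case=> _ fM f1; elim: n => [|n IHn]; first by rewrite !expr0.
by rewrite !exprS fM IHn.
Qed.

Lemma tf0 H K : K \subset H -> tf H K 0 = 0.
Proof.
by move=> sKH; apply: (@addrI _ (tf H K 0)); rewrite -(tr_add _ _ hT) // !addr0.
Qed.

Lemma nmX H K (x : R K) n : K \subset H -> nm H K (x ^+ n) = nm H K x ^+ n.
Proof.
move=> sKH; elim: n => [|n IHn]; first by rewrite !expr0 (nm_one _ _ hT).
by rewrite !exprS (nm_mul _ _ hT) // IHn.
Qed.

Lemma cj1 H (x : R H) : cj 1%g H H x = x.
Proof. exact: (cj_inner _ _ hT). Qed.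

Lemma cjK (g : gT) H K (x : R K) : (K :=: H :^ g^-1)%g ->
  cj g H K (cj g^-1%g K H x) = x.
Proof.
move=> eK; rewrite (cj_comp _ _ hT) // ?mulgV ?cj1 //.
by rewrite eK -conjsgM invgK mulVg conjsg1.
Qed.

Lemma rs_hom {H K} : K \subset H -> ringhom (rs H K).
Proof. exact: (res_rmorph _ _ hT). Qed.

Lemma cj_hom {g : gT} {H K} : (K :=: H :^ g^-1)%g -> ringhom (cj g H K).
Proof. exact: (cj_rmorph _ _ hT). Qed.

Lemma lactM (a b : gT) (U : {set {set gT}}) :
  lact gT (a * b)%g U = lact gT a (lact gT b U).
Proof.
rewrite /lact -imset_comp; apply: eq_imset => C /=.
by rewrite !lcosetE lcosetM.
Qed.

Lemma lact1 (U : {set {set gT}}) : lact gT 1%g U = U.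
Proof.
rewrite /lact -[RHS]imset_id; apply: eq_imset => C.
by rewrite lcosetE lcoset1.
Qed.

Lemma lact0 (h : gT) : lact gT h set0 = set0.
Proof. exact: imset0. Qed.

Lemma mem_stab_grp (H : {set gT}) (U : {set {set gT}}) h :
  group_set H -> (h \in stab_grp gT H U) = (h \in H) && (lact gT h U == U).
Proof.
move=> gH.
have gS : group_set [set h in H | lact gT h U == U].
  apply/group_setP; split=> [|a b].
    by rewrite inE (group1 (Group gH)) lact1 /=.
  rewrite !inE => /andP[aH /eqP aU] /andP[bH /eqP bU].
  by rewrite (groupM (G := Group gH)) //= lactM bU aU.
by rewrite /stab_grp /= (gen_set_id gS) inE.
Qed.

Lemma stab_grp_sub H (U : {set {set gT}}) : stab_grp gT H U \subset H.
Proof. by apply/subsetP=> h; rewrite mem_stab_grp ?groupP // => /andP[]. Qed.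

Lemma is_idealP I :
  [/\ forall H, I H 0,
      forall H x y, I H x -> I H y -> I H (x + y)
    & forall H x y, I H y -> I H (x * y)] ->
  [/\ forall H K x, K \subset H -> I H x -> I K (rs H K x),
      forall H K x, K \subset H -> I K x -> I H (tf H K x),
      forall H K x, K \subset H -> I K x -> I H (nm H K x)
    & forall g H K x, (K :=: H :^ g^-1)%g -> I H x -> I K (cj g H K x)] ->
  is_ideal I.
Proof.
move=> [I0 ID IM] [Ir It In Ic]; do !split=> //.
  move=> Ky; exists (cj g^-1%g K H y); last by rewrite cjK.
  by apply: Ic => //; rewrite H0 -conjsgM invgK mulVg conjsg1.
by case=> x Ix ->; apply: Ic.
Qed.

Definition absorbing F :=
  [/\ forall H, F H 0, forall H x y, F H y -> F H (x * y),
      forall H K x, K \subset H -> F H x -> F K (rs H K x),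
      forall H K x, K \subset H -> F K x -> F H (nm H K x)
    & forall g H K x, (K :=: H :^ g^-1)%g -> F H x -> F K (cj g H K x)].

Lemma ideal_absorbing I : is_ideal I -> absorbing I.
Proof.
case=> I0 [ID [IM [Ir [It [In Ic]]]]]; split=> // g H K x eK Ix.
by apply/(Ic _ _ _ eK); exists x.
Qed.

Lemma idealD I : is_ideal I -> forall H x y, I H x -> I H y -> I H (x + y).
Proof. by case=> _ []. Qed.

Lemma ideal_tf I : is_ideal I ->
  forall H K x, K \subset H -> I K x -> I H (tf H K x).
Proof. by case=> _ [_ [_ [_ []]]]. Qed.

Lemma idealMr I : is_ideal I -> forall H x y, I H x -> I H (x * y).
Proof. by move=> iI H x y Ix; rewrite mulrC; case: (ideal_absorbing iI) => _ IM _ _ _; apply: IM. Qed.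

Lemma ideal_sum I : is_ideal I -> forall H n (a : 'I_n -> R H),
  (forall i, I H (a i)) -> I H (\sum_(i < n) a i).
Proof.
move=> iI H n a Ia; have [I0 _ _ _ _] := ideal_absorbing iI.
by elim/big_ind: _ => // x y; apply: idealD.
Qed.

Unset Implicit Arguments.
Inductive span F : tpred T :=
| span0 H : span F H 0
| spanD H x y of span F H x & span F H y : span F H (x + y)
| span_tf H K f of K \subset H & F K f : span F H (tf H K f).
Set Implicit Arguments.
Arguments span0 {F}.
Arguments spanD {F H x y}.
Arguments span_tf {F H K f}.

Lemma span_sub F I : is_ideal I -> tsub F I -> tsub (span F) I.
Proof.
move=> iI sFI H z; elim=> {H z} [H|H x y _ Ix _ Iy|H K f sKH Ff].
- by case: (ideal_absorbing iI).
- exact: idealD.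
- by apply: ideal_tf => //; apply: sFI.
Qed.

Lemma sub_span F : tsub F (span F).
Proof. by move=> H x Fx; rewrite -[x](tr_id _ _ hT); apply: span_tf. Qed.

Lemma span_bigsum F H (J : finType) (Q : pred J) (a : J -> R H) :
  (forall i, Q i -> span F H (a i)) -> span F H (\sum_(i | Q i) a i).
Proof. by move=> Fa; elim/big_ind: _ => // [|x y]; [apply: span0 | apply: spanD]. Qed.

Section SpanIdeal.
Variable F : tpred T.
Arguments F : clear implicits.
Hypothesis aF : absorbing F.

Lemma spanM H x y : span F H y -> span F H (x * y).
Proof.
have [_ FM _ _ _] := aF.
move=> Fy; elim: Fy x => {H y} [H|H y z _ Fy _ Fz|H K f sKH Ff] x.
- by rewrite mulr0; apply: span0.
- by rewrite mulrDr; apply: spanD.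
- by rewrite mulrC -(frobenius _ _ hT) // mulrC; apply: span_tf => //; apply: FM.
Qed.

Lemma span_tr H K x : K \subset H -> span F K x -> span F H (tf H K x).
Proof.
move=> sKH Fx; elim: Fx H sKH => {K x} [K|K y z _ Fy _ Fz|K L f sLK Ff] H sKH.
- by rewrite tf0 //; apply: span0.
- by rewrite (tr_add _ _ hT) //; apply: spanD; [apply: Fy | apply: Fz].
- by rewrite (tr_comp _ _ hT) //; apply: span_tf => //; apply: subset_trans sKH.
Qed.

Lemma dcoset_conj K L (d : gT) :
  (K :&: L :^ d^-1)%G :=: (((K :^ d) :&: L)%G :^ d^-1)%g.
Proof. by rewrite /= conjIg conjsgK. Qed.

Lemma span_rs H K x : K \subset H -> span F H x -> span F K (rs H K x).
Proof.
have [_ _ Fr _ Fc] := aF.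
move=> sKH Fx; elim: Fx K sKH => {H x} [H|H y z _ Fy _ Fz|H L f sLH Ff] K sKH.
- by rewrite (ringhom0 (rs_hom sKH)); apply: span0.
- by have [-> _ _] := rs_hom sKH; apply: spanD; [apply: Fy | apply: Fz].
- rewrite (double_coset_tr _ _ hT) //; apply: span_bigsum => D _.
  apply: span_tf; first exact: subsetIl.
  by apply: Fc; [apply: dcoset_conj | apply: Fr => //; apply: subsetIr].
Qed.

Lemma span_cj g H K x : (K :=: H :^ g^-1)%g ->
  span F H x -> span F K (cj g H K x).
Proof.
have [_ _ Fr _ Fc] := aF.
move=> eK Fx; elim: Fx K eK => {H x} [H|H y z _ Fy _ Fz|H L f sLH Ff] K eK.
- by rewrite (ringhom0 (cj_hom eK)); apply: span0.
- by have [-> _ _] := cj_hom eK; apply: spanD; [apply: Fy | apply: Fz].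
- rewrite (@cj_tr _ _ hT _ _ _ K (L :^ g^-1)%G) //.
  apply: span_tf; last exact: Fc.
  by rewrite /= eK conjSg.
Qed.

Lemma lcosets_lcoset H L C h : L \subset H -> h \in H ->
  C \in lcosets L H -> lcoset C h \in lcosets L H.
Proof.
move=> sLH hH /lcosetsP[x xH ->].
by apply/lcosetsP; exists (h * x)%g; rewrite ?groupM // lcosetE lcosetM.
Qed.

Lemma lact_sections L K H h (S : {set {set gT}}) :
  L \subset K -> K \subset H -> h \in H ->
  S \in sections gT L K H -> lact gT h S \in sections gT L K H.
Proof.
move=> sLK sKH hH; have sLH := subset_trans sLK sKH.
rewrite !inE => /andP[/subsetP sS /forall_inP oneS]; apply/andP; split.
  by apply/subsetP=> _ /imsetP[D DS ->]; apply: lcosets_lcoset => //; apply: sS.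
apply/forall_inP=> C CKH.
have hVCK : lcoset C h^-1%g \in lcosets K H by rewrite lcosets_lcoset ?groupV.
rewrite -(eqP (oneS _ hVCK)).
have inj_h : injective (fun D : {set gT} => lcoset D h).
  by move=> D E; rewrite !lcosetE; apply: (can_inj (lcosetK h)).
rewrite -[X in _ == X](card_imset _ inj_h); apply/eqP; apply: eq_card => D.
rewrite inE; apply/andP/imsetP=> [[/imsetP[E ES ->] sEC]|[E]].
  exists E => //; rewrite inE ES /=; move: sEC.
  by rewrite !lcosetE sub_lcosetV.
rewrite inE => /andP[ES sEC] ->; split; first exact: imset_f.
by move: sEC; rewrite !lcosetE sub_lcosetV.
Qed.

Lemma section_orbit_pick L K H O : L \subset K -> K \subset H ->
  O \in section_orbits gT L K H ->
  odflt set0 [pick S in O] \in sections gT L K H.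
Proof.
move=> sLK sKH /imsetP[S0 secS0 ->].
case: pickP => [U /imsetP[h hH ->]|/(_ (lact gT 1%g S0))]; first exact: lact_sections.
by rewrite (imset_f (fun h => lact gT h S0)).
Qed.

Lemma coset_orbit_pick (S : {group gT}) K H w : S \subset H -> K \subset H ->
  w \in coset_orbits gT S K H ->
  odflt set0 [pick C in w] \in lcosets K H.
Proof.
move=> sSH sKH /imsetP[C0 C0K ->].
case: pickP => [C /imsetP[s sS ->]|/(_ (lcoset C0 1%g))].
  by apply: lcosets_lcoset => //; apply: (subsetP sSH).
by rewrite (imset_f (fun s => lcoset C0 s)).
Qed.

Lemma section_stab L K H U C D : L \subset K -> K \subset H ->
  U \in sections gT L K H -> C \in lcosets K H -> D \in U -> D \subset C ->
  (stab_grp gT H U :&: K :^ (repr D)^-1)%g \subset (L :^ (repr D)^-1)%g.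
Proof.
move=> sLK sKH secU CKH DU sDC.
move: secU; rewrite inE => /andP[sU /forall_inP/(_ C CKH)/cards1P[D0 oneD]].
have inD0 E : E \in U -> E \subset C -> E = D0.
  by move=> EU sEC; apply/set1P; rewrite -oneD inE EU.
rewrite powersetE in sU.
have /lcosetsP[x xH eD] := subsetP sU D DU.
have DL : D = (repr D *: L)%g 
  by rewrite eD; apply/esym/lcoset_eqP/(mem_repr x)/lcoset_refl.
set g := repr D in DL *.
have /lcosetsP[y yH eC] := CKH.
have CK : C = (g *: K)%g.
  rewrite eC; apply/esym/lcoset_eqP; rewrite -eC (subsetP sDC) //.
  by rewrite DL lcoset_refl.
apply/subsetP=> s /setIP[]; rewrite mem_stab_grp ?groupP // => /andP[sH /eqP sU'].
rewrite mem_conjgV => sgK.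
have sDU : lcoset D s \in U by rewrite -sU'; apply: imset_f.
have sgE : (s * g = g * s ^ g)%g by rewrite conjgC.
have sDC' : lcoset D s \subset C.
  rewrite lcosetE {1}DL -lcosetM sgE lcosetM CK.
  by rewrite lcosetS -(lcoset_id sgK) lcosetS.
have : lcoset D s = D by rewrite (inD0 _ sDU) // (inD0 D).
rewrite lcosetE {1}DL -lcosetM sgE {1}DL => eD2.
rewrite mem_conjgV; have : (g * s ^ g)%g \in (g *: L)%g.
  by rewrite -eD2 lcoset_refl.
by rewrite mem_lcoset mulKg.
Qed.

Lemma coset_orbits_neq0 (S : {set gT}) K H :
  exists w, w \in coset_orbits gT S K H.
Proof.
exists [set lcoset C s | C in [set lcoset K 1%g], s in S].
apply/imsetP; exists (lcoset K 1%g); first by apply: imset_f.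
by apply/setP=> X; apply/imset2P/imsetP=> [[C s /set1P-> sS ->]|[s sS ->]];
  [exists s | exists (lcoset K 1%g) s => //; rewrite set11].
Qed.

Lemma span_nm_tr H K L f : L \subset K -> K \subset H -> F L f ->
  span F H (nm H K (tf K L f)).
Proof.
have [_ FM Fr Fn Fc] := aF.
move=> sLK sKH Ff; rewrite (tambara_tr _ _ hT) //; apply: span_bigsum => O OS.
have secU := section_orbit_pick sLK sKH OS.
set U := odflt _ _ in secU *; set S := stab_grp _ _ _.
have sSH : S \subset H by apply: stab_grp_sub.
apply: span_tf => //.
have [w wS] := coset_orbits_neq0 S K H.
rewrite (bigD1 w) //= mulrC; apply: FM.
have CKH := coset_orbit_pick sSH sKH wS.
set C := odflt _ _ in CKH *.
have [DU sDC] : odflt set0 [pick D in U | D \subset C] \in U /\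
                odflt set0 [pick D in U | D \subset C] \subset C.
  case: pickP => [D /andP[] //|noD].
  move: secU; rewrite inE => /andP[_ /forall_inP/(_ C CKH)/cards1P[D0 oneD]].
  by have /setP/(_ D0) := oneD; rewrite inE set11; have /= -> := noD D0.
apply: Fn; first exact: subsetIl.
apply: Fr; first exact: section_stab CKH DU sDC.
exact: Fc.
Qed.

Lemma span_nm_sum H K (a b : R K) : K \subset H ->
  (forall (S N : {group gT}) (g : gT), N \subset S -> N \subset (K :^ g^-1)%G ->
    span F S (nm S N (rs (K :^ g^-1)%G N (cj g K (K :^ g^-1)%G a)))) ->
  (forall (S N : {group gT}) (g : gT), N \subset S -> N \subset (K :^ g^-1)%G ->
    span F S (nm S N (rs (K :^ g^-1)%G N (cj g K (K :^ g^-1)%G b)))) ->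
  span F H (nm H K (a + b)).
Proof.
move=> sKH Fa Fb; rewrite (tambara_sum _ _ hT) //; apply: span_bigsum => O _.
set U := odflt _ _; set S := stab_grp _ _ _.
apply: span_tr; first exact: stab_grp_sub.
have [w wS] := coset_orbits_neq0 S K H.
rewrite (bigD1 w) //= mulrC; apply: spanM.
by case: ifP => _; [apply: Fa | apply: Fb]; rewrite /= (subsetIl, subsetIr).
Qed.

(* Restrictions of a transfer are sums of transfers from smaller levels: hence
   the outer induction on the order of K, with an inner one on the number of
   summands. *)
Lemma span_nm_rs_cj g H K K' L x : (K' :=: K :^ g^-1)%g -> L \subset K' ->
  L \subset H -> span F K x -> span F H (nm H L (rs K' L (cj g K K' x))).
Proof.
have [F0 _ _ Fn Fc] := aF.
have [n] := ubnP #|K|; elim: n => // n IHn in g H K K' L x * => leKn.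
move=> eK sLK' sLH Fx.
elim: Fx g H K' L eK sLK' sLH leKn => {K x} [K|K y z _ Fy _ Fz|K M f sMK Ff].
- move=> g H K' L eK sLK' sLH _; rewrite (ringhom0 (cj_hom eK)).
  rewrite (ringhom0 (rs_hom sLK')).
  by apply: sub_span; apply: Fn.
- move=> g H K' L eK sLK' sLH leKn.
  have [-> _ _] := cj_hom eK; have [-> _ _] := rs_hom sLK'.
  apply: span_nm_sum => // S N h sNS sNL;
    rewrite (@cj_res _ _ hT _ _ _ (K' :^ h^-1)%G (L :^ h^-1)%G) //;
    rewrite (res_comp _ _ hT) ?conjSg // (@cj_comp _ _ hT _ _ _ _ (K' :^ h^-1)%G) //.
  + apply: Fy => //; last by apply: subset_trans sNL _; rewrite conjSg.
    by rewrite /= eK -conjsgM invMg.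
  + apply: Fz => //; last by apply: subset_trans sNL _; rewrite conjSg.
    by rewrite /= eK -conjsgM invMg.
- move=> g H K' L eK sLK' sLH leKn.
  have Fcf : span F K' (cj g K K' (tf K M f)).
    by apply: span_cj => //; apply: span_tf.
  have cardK : #|K'| = #|K| by rewrite eK cardJg.
  have [ltLK|geLK] := ltnP #|L| #|K'|.
    have ltLn : (#|L| < n)%N by move: leKn; rewrite -cardK ltnS; apply: leq_trans.
    have eL : (L :=: L :^ 1^-1)%g by rewrite invg1 conjsg1.
    have := IHn 1%g H L L L _ ltLn eL (subxx _) sLH (span_rs sLK' Fcf).
    by rewrite cj1 (res_id _ _ hT).
  have eL : L = K' by apply: group_inj; apply/eqP; rewrite eqEcard sLK' geLK.
  subst L; rewrite (res_id _ _ hT) (@cj_tr _ _ hT _ _ _ K' (M :^ g^-1)%G) //.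
  by apply: span_nm_tr => //; [rewrite /= eK conjSg | apply: Fc].
Qed.

Lemma span_nm H K x : K \subset H -> span F K x -> span F H (nm H K x).
Proof.
move=> sKH /(@span_nm_rs_cj 1 H K K K); rewrite cj1 (res_id _ _ hT); apply => //.
by rewrite invg1 conjsg1.
Qed.

Lemma span_ideal : is_ideal (span F).
Proof.
apply: is_idealP; split.
- exact: span0.
- by move=> *; apply: spanD.
- exact: spanM.
- exact: span_rs.
- exact: span_tr.
- exact: span_nm.
- exact: span_cj.
Qed.
End SpanIdeal.

Lemma lact_lcosets K H h : K \subset H -> h \in H ->
  lact gT h (lcosets K H) = lcosets K H.
Proof.
move=> sKH hH; apply/eqP; rewrite eqEcard; apply/andP; split.
  by apply/subsetP=> _ /imsetP[C CK ->]; apply: lcosets_lcoset.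
rewrite (card_imset (f := fun C => lcoset C h)) // => D E.
by rewrite !lcosetE; apply: (can_inj (lcosetK h)).
Qed.

Lemma lact_invariant K H (U : {set {set gT}}) : U \subset lcosets K H ->
  (forall h, h \in H -> lact gT h U = U) -> U = set0 \/ U = lcosets K H.
Proof.
move=> sU invU; have [->|[C CU]] := set_0Vmem U; [by left | right].
apply/eqP; rewrite eqEsubset sU /=; apply/subsetP=> _ /lcosetsP[y yH ->].
have /lcosetsP[x xH eC] := subsetP sU C CU.
rewrite -(invU (y * x^-1)%g) ?groupM ?groupV //; apply/imsetP; exists C => //.
by rewrite lcosetE eC -lcosetM mulgKV.
Qed.

Lemma coset_orbits_full K H : K \subset H ->
  coset_orbits gT H K H = [set lcosets K H].
Proof.
move=> sKH; have orbE C : C \in lcosets K H ->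
    [set lcoset C s | s in H] = lcosets K H.
  move=> CK; apply/eqP; rewrite eqEsubset; apply/andP; split.
    by apply/subsetP=> _ /imsetP[h hH ->]; apply: lcosets_lcoset.
  have /lcosetsP[x xH eC] := CK; apply/subsetP=> _ /lcosetsP[y yH ->].
  apply/imsetP; exists (y * x^-1)%g; first by rewrite groupM ?groupV.
  by rewrite lcosetE eC -lcosetM mulgKV.
apply/setP=> w; rewrite inE; apply/imsetP/eqP=> [[C CK ->]|->]; first exact: orbE.
exists (lcoset K 1%g); first exact: imset_f.
by rewrite orbE //; apply: imset_f.
Qed.

Lemma nm0_conj H K g : K \subset H -> g \in H ->
  nm H (K :^ g^-1)%G 0 = nm H K 0.
Proof.
move=> sKH gH; have eH : (H :=: H :^ g^-1)%g by rewrite conjGid ?groupV.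
rewrite -[RHS](cj_inner _ _ hT g) // (@cj_nm _ _ hT _ _ _ H (K :^ g^-1)%G) //.
by rewrite (ringhom0 (@cj_hom _ _ _ _)).
Qed.

(* In the formula for N(0 + 0) the terms with a proper stabilizer vanish by
   induction, and there are exactly two other terms, for U empty and for U full,
   both equal to N(0): hence N(0) = N(0) + N(0). *)
Lemma nm0 H K : K \subset H -> nm H K 0 = 0.
Proof.
have [n] := ubnP #|H|; elim: n => // n IHn in H K * => leHn sKH.
pose term (U : {set {set gT}}) : R H := tf H (stab_grp gT H U)
  (\prod_(w in coset_orbits gT (stab_grp gT H U) K H)
     nm (stab_grp gT H U)
       (stab_grp gT H U :&: K :^ (repr (odflt set0 [pick C in w]))^-1)%G
       (rs (K :^ (repr (odflt set0 [pick C in w]))^-1)%G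
           (stab_grp gT H U :&: K :^ (repr (odflt set0 [pick C in w]))^-1)%G
           (cj (repr (odflt set0 [pick C in w])) K
               (K :^ (repr (odflt set0 [pick C in w]))^-1)%G 0))).
have sumE : nm H K 0 =
    \sum_(O in subset_orbits gT K H) term (odflt set0 [pick U in O]).
  rewrite -[X in nm H K X]addr0 (tambara_sum _ _ hT) //.
  apply: eq_bigr => O _; congr (tf _ _ _); apply: eq_bigr => w _.
  by rewrite if_same.
have term_proper U : stab_grp gT H U != H -> term U = 0.
  move=> neqSH; have sSH := stab_grp_sub H U.
  have ltSn : (#|stab_grp gT H U| < n)%N.
    apply: leq_trans (leHn : (#|H| <= n)%N); apply: proper_card.
    rewrite properEneq sSH andbT; apply: contraNneq neqSH => eS.
    exact/eqP/group_inj.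
  rewrite /term; have [w wS] := coset_orbits_neq0 (stab_grp gT H U) K H.
  rewrite (bigD1 w) //= (ringhom0 (@cj_hom _ _ _ _)) //.
  rewrite (ringhom0 (@rs_hom _ _ _)) ?subsetIr // IHn ?subsetIl //.
  by rewrite mul0r tf0.
have term_full U : stab_grp gT H U = H -> term U = nm H K 0.
  move=> eS; rewrite /term eS (tr_id _ _ hT) coset_orbits_full // big_set1.
  set g := repr _.
  have gH : g \in H.
    rewrite /g; case: pickP => [C /lcosetsP[x xH ->]|/(_ (lcoset K 1%g))] /=.
      have /lcosetP[k kK ->] := mem_repr x (lcoset_refl K x).
      by rewrite groupM // (subsetP sKH).
    by rewrite (imset_f (lcoset K)).
  have sKgH : (K :^ g^-1)%g \subset H by rewrite sub_conjgV conjGid.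
  have eK : (H :&: K :^ g^-1)%G = (K :^ g^-1)%G.
    by apply: group_inj; apply/setIidPr.
  rewrite eK (res_id _ _ hT) (ringhom0 (@cj_hom _ _ _ _)) //.
  exact: nm0_conj.
have stab_full (U : {set {set gT}}) :
    (forall h, h \in H -> lact gT h U = U) -> stab_grp gT H U = H.
  move=> invU; apply: group_inj; apply/setP=> h.
  by rewrite mem_stab_grp ?groupP //; case hH: (h \in H); rewrite //= invU ?eqxx.
have orbit_fixed (U : {set {set gT}}) :
    (forall h, h \in H -> lact gT h U = U) -> [set lact gT h U | h in H] = [set U].
  move=> invU; apply/setP=> V; rewrite inE; apply/imsetP/eqP=> [[h hH ->]|->].
    exact: invU.
  by exists 1%g; rewrite ?group1 ?lact1.
have pick_set1 (U : {set {set gT}}) : odflt set0 [pick V in [set U]] = U.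
  by case: pickP => [V /set1P//|/(_ U)]; rewrite set11.
have inv0 h : h \in H -> lact gT h set0 = set0 by rewrite lact0.
have invT h : h \in H -> lact gT h (lcosets K H) = lcosets K H.
  exact: lact_lcosets.
have O0 : [set set0] \in subset_orbits gT K H.
  by apply/imsetP; exists set0; rewrite ?orbit_fixed // powersetE sub0set.
have OT : [set lcosets K H] \in subset_orbits gT K H.
  by apply/imsetP; exists (lcosets K H); rewrite ?orbit_fixed // powersetE.
have neqOT : [set lcosets K H] != [set set0].
  apply/eqP=> /set1_inj eT.
  by have := imset_f (lcoset K) (group1 H); rewrite [_ @: _]eT inE.
have := sumE; rewrite (bigD1 _ O0) (bigD1 [set lcosets K H]) /=; last exact/andP.
rewrite !pick_set1 !term_full ?stab_full // big1 ?addr0.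
  by move=> eN; apply: (@addrI _ (nm H K 0)); rewrite addr0 -eN.
move=> O /andP[/andP[/imsetP[U0]]]; rewrite powersetE => sU0 eO neO0 neOT.
apply: term_proper; apply/eqP=> eS.
set U := odflt _ _ in eS.
have [h hH eU] : exists2 h, h \in H & U = lact gT h U0.
  rewrite /U; case: pickP => [V|/(_ U0)]; first by rewrite eO => /imsetP.
  by rewrite eO -{1}[U0]lact1 (imset_f (fun h => lact gT h U0)).
have invU k : k \in H -> lact gT k U = U.
  by rewrite -{1}eS mem_stab_grp ?groupP // => /andP[_ /eqP].
have eU0 : U0 = U.
  by rewrite -(invU h^-1%g) ?groupV // eU -lactM mulVg lact1.
rewrite eU0 in sU0 eO; have := lact_invariant sU0 invU.
case=> eU1; move: neO0 neOT; rewrite eO orbit_fixed // eU1 eqxx //.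
Qed.

Definition pprod A B : tpred T :=
  fun H z => exists a b, [/\ A H a, B H b & z = a * b].

Lemma pprod_absorbing A B : absorbing A -> absorbing B -> absorbing (pprod A B).
Proof.
case=> A0 AM Ar An Ac [B0 _ Br Bn Bc]; split.
- by move=> H; exists 0, 0; rewrite mul0r.
- by move=> H x _ [a [b [Aa Bb ->]]]; exists (x * a), b; rewrite mulrA; split=> //; apply: AM.
- move=> H K _ sKH [a [b [Aa Bb ->]]]; have [_ -> _] := rs_hom sKH.
  by exists (rs H K a), (rs H K b); split=> //; [apply: Ar | apply: Br].
- move=> H K _ sKH [a [b [Aa Bb ->]]]; rewrite (nm_mul _ _ hT) //.
  by exists (nm H K a), (nm H K b); split=> //; [apply: An | apply: Bn].
- move=> g H K _ eK [a [b [Aa Bb ->]]]; have [_ -> _] := cj_hom eK.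
  by exists (cj g H K a), (cj g H K b); split=> //; [apply: Ac eK _ | apply: Bc eK _].
Qed.

Lemma span_mul A B H a b : absorbing A -> absorbing B ->
  span A H a -> span B H b -> span (pprod A B) H (a * b).
Proof.
move=> aA aB; have [_ _ Ar _ _] := aA.
have base K f c : A K f -> span B K c -> span (pprod A B) K (f * c).
  move=> Af Bc; elim: Bc f Af => {K c} [K|K x y _ Bx _ By|K L h sLK Bh] f Af.
  - by rewrite mulr0; apply: span0.
  - by rewrite mulrDr; apply: spanD; [apply: Bx | apply: By].
  - rewrite mulrC -(frobenius _ _ hT) // mulrC; apply: span_tf => //.
    by exists (rs K L f), h; split=> //; apply: Ar.
move=> Aa; elim: Aa b => {H a} [H|H x y _ Ax _ Ay|H K f sKH Af] b Bb.
- by rewrite mul0r; apply: span0.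
- by rewrite mulrDl; apply: spanD; [apply: Ax | apply: Ay].
- rewrite -(frobenius _ _ hT) //; apply: span_tr => //.
  by apply: base => //; apply: span_rs.
Qed.

Lemma sub_gen (X : tpred T) : tsub X (gen X).
Proof. by move=> H x Xx J _; apply. Qed.

Lemma meet_ideal (Q : tpred T -> Prop) :
  is_ideal (fun H x => forall J, is_ideal J -> Q J -> J H x).
Proof.
apply: is_idealP; split.
- by move=> H J /ideal_absorbing[].
- by move=> H x y Ix Iy J iJ QJ; apply: idealD => //; [apply: Ix | apply: Iy].
- move=> H x y Iy J iJ QJ; have [_ JM _ _ _] := ideal_absorbing iJ.
  by apply: JM => //; apply: Iy.
- move=> H K x sKH Ix J iJ QJ; have [_ _ Jr _ _] := ideal_absorbing iJ.
  by apply: Jr => //; apply: Ix.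
- by move=> H K x sKH Ix J iJ QJ; apply: (ideal_tf iJ sKH); apply: Ix.
- move=> H K x sKH Ix J iJ QJ; have [_ _ _ Jn _] := ideal_absorbing iJ.
  by apply: Jn => //; apply: Ix.
- move=> g H K x eK Ix J iJ QJ; have [_ _ _ _ Jc] := ideal_absorbing iJ.
  by apply: (Jc _ _ _ _ eK); apply: Ix.
Qed.

Lemma iprod_ideal I J : is_ideal (iprod I J).
Proof. exact: meet_ideal. Qed.

Lemma mem_iprod I J H a b : I H a -> J H b -> iprod I J H (a * b).
Proof.
move=> Ia Jb; apply: sub_gen; exists 1%N, (fun=> a), (fun=> b).
by rewrite big_ord1.
Qed.

Lemma iprod_sub I J P : is_ideal P ->
  (forall H a b, I H a -> J H b -> P H (a * b)) -> tsub (iprod I J) P.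
Proof.
move=> iP IJP H z; apply=> // K _ [n [a [b [Ia Jb ->]]]].
by apply: ideal_sum => // i; apply: IJP.
Qed.

Section PrincipalIdeal.
Variables (H0 : {group gT}) (x0 : R H0).

Definition conj_norm K (p : {group gT} * gT) : R K :=
  nm K p.1 (rs (H0 :^ p.2^-1)%G p.1 (cj p.2 H0 (H0 :^ p.2^-1)%G x0)).

Definition conj_norm_valid K (p : {group gT} * gT) :=
  (p.1 \subset K) && (p.1 \subset (H0 :^ p.2^-1)%G).

Definition conj_norm_mul : tpred T := fun K z =>
  exists c p, conj_norm_valid K p /\ z = c * conj_norm K p.

Lemma conj_norm_mul_absorbing : absorbing conj_norm_mul.
Proof.
split.
- move=> H; exists 0, (1%G, 1%g); rewrite mul0r /conj_norm_valid /=.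
  by rewrite !sub1G.
- by move=> H x _ [c [p [vp ->]]]; exists (x * c), p; rewrite mulrA.
- move=> H K _ sKH [c [[M g] [/andP[/= sMH sMg] ->]]].
  have [_ -> _] := rs_hom sKH.
  rewrite /conj_norm /= (double_coset_nm _ _ hT) // /dc_nm_rhs.
  have D1 : ((K :* 1) * M)%g \in dcosets gT K M H by apply: imset_f.
  rewrite (bigD1 _ D1) /= mulrCA mulrC; set d := repr _; set P := bigop _ _ _.
  exists (rs H K c * P), ((K :&: M :^ d^-1)%G, d * g)%g; split.
    rewrite /conj_norm_valid /= subsetIl invMg conjsgM.
    by rewrite subIset // conjSg sMg orbT.
  congr (_ * _); rewrite /conj_norm /=; congr (nm _ _ _).
  rewrite (res_comp _ _ hT) ?subsetIr //.
  have ed : (K :&: M :^ d^-1)%G :=: (((K :^ d) :&: M)%G :^ d^-1)%g.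
    exact: dcoset_conj.
  have eg : (H0 :^ (d * g)^-1)%G :=: ((H0 :^ g^-1)%G :^ d^-1)%g.
    by rewrite /= invMg conjsgM.
  rewrite (@cj_res _ _ hT _ _ _ (H0 :^ (d * g)^-1)%G) //.
    by rewrite (cj_comp _ _ hT).
  by rewrite subIset // sMg orbT.
- move=> H K _ sKH [c [[M g] [/andP[/= sMK sMg] ->]]].
  rewrite (nm_mul _ _ hT) // /conj_norm (nm_comp _ _ hT) //=.
  exists (nm H K c), (M, g); split=> //.
  by rewrite /conj_norm_valid /= sMg (subset_trans sMK).
- move=> h H K _ eK [c [[M g] [/andP[/= sMH sMg] ->]]].
  have [_ -> _] := cj_hom eK.
  exists (cj h H K c), ((M :^ h^-1)%G, h * g)%g; split.
    by rewrite /conj_norm_valid /= eK invMg conjsgM !conjSg sMH.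
  congr (_ * _); rewrite /conj_norm /= (@cj_nm _ _ hT _ _ _ K (M :^ h^-1)%G) //.
  congr (nm _ _ _).
  have eg : (H0 :^ (h * g)^-1)%G :=: ((H0 :^ g^-1)%G :^ h^-1)%g.
    by rewrite /= invMg conjsgM.
  by rewrite (@cj_res _ _ hT _ _ _ (H0 :^ (h * g)^-1)%G) // (cj_comp _ _ hT).
Qed.

Lemma gen1_sub_span : tsub (gen1 H0 x0) (span conj_norm_mul).
Proof.
move=> H x; apply; first by apply: span_ideal; apply: conj_norm_mul_absorbing.
apply: sub_span; exists 1, (H0, 1%g); rewrite /conj_norm_valid /conj_norm /=.
have -> : (H0 :^ 1^-1)%G = H0 by apply: group_inj; rewrite /= invg1 conjsg1.
by rewrite invg1 conjsg1 subxx mul1r cj1 (res_id _ _ hT) (nm_id _ _ hT).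
Qed.

Definition conj_norm_pow n : tpred T :=
  iter n (fun A => pprod A conj_norm_mul) conj_norm_mul.
Arguments conj_norm_pow n : clear implicits.

Lemma conj_norm_pow_absorbing n : absorbing (conj_norm_pow n).
Proof.
elim: n => [|n IHn]; first exact: conj_norm_mul_absorbing.
exact: pprod_absorbing IHn conj_norm_mul_absorbing.
Qed.

Lemma ipow_gen1_sub n :
  tsub (ipow (gen1 H0 x0) n.+1) (span (conj_norm_pow n)).
Proof.
elim: n => [|n IHn]; first exact: gen1_sub_span.
apply: iprod_sub => [|H a b Aa Bb].
  by apply: span_ideal; apply: conj_norm_pow_absorbing.
apply: span_mul; [exact: conj_norm_pow_absorbing|exact: conj_norm_mul_absorbing| |].
  exact: IHn.
exact: gen1_sub_span.
Qed.

Lemma conj_norm_powE n K z : conj_norm_pow n K z -> exists c s,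
  [/\ size s = n.+1, all (conj_norm_valid K) s &
      z = c * \prod_(p <- s) conj_norm K p].
Proof.
elim: n z => [|n IHn] z.
  by case=> c [p [vp ->]]; exists c, [:: p]; rewrite /= vp big_seq1.
case=> _ [_ [/IHn[c [s [ss vs ->]]] [c' [p [vp ->]]] ->]].
exists (c' * c), (p :: s); rewrite /= ss vp vs big_cons; split=> //.
by rewrite mulrC mulrACA.
Qed.

Lemma conj_norm_nilp I n K p : is_ideal I -> I H0 (x0 ^+ n) ->
  conj_norm_valid K p -> I K (conj_norm K p ^+ n).
Proof.
move=> iI Ix /andP[sMK sMg]; have [_ _ Ir In Ic] := ideal_absorbing iI.
rewrite /conj_norm -nmX // -(ringhomX _ _ (rs_hom sMg)).
have eg : (H0 :^ p.2^-1)%G :=: (H0 :^ p.2^-1)%g by [].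
rewrite -(ringhomX _ _ (cj_hom eg)).
by apply: In => //; apply: Ir => //; apply: Ic.
Qed.

Lemma seq_pigeonhole (J : finType) (s : seq J) n :
  (#|J| * n < size s)%N -> exists p, (n < count_mem p s)%N.
Proof.
move=> lt_s; apply/existsP; apply: contraLR lt_s => /existsPn le_n.
rewrite -leqNgt -sum1_size (partition_big id xpredT) //=.
rewrite -sum_nat_const; apply: leq_sum => p _.
by rewrite sum1_count; have := le_n p; rewrite -leqNgt.
Qed.

(* Only finitely many elements N r c_g x generate <x>, and they are nilpotent
   modulo I as soon as x is: a long product of them contains a high power. *)
Lemma ipow_gen1_nilp I n : is_ideal I -> I H0 (x0 ^+ n) ->
  exists m, tsub (ipow (gen1 H0 x0) m.+1) I.
Proof.
move=> iI Ix; exists (#|{: {group gT} * gT}| * n)%N => H z /ipow_gen1_sub.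
apply: span_sub => // K {}z /conj_norm_powE[c [s [ss vs ->]]].
have [_ IM _ _ _] := ideal_absorbing iI; apply: (IM).
have [|p ltnp] := @seq_pigeonhole _ s n; first by rewrite ss.
have vp : conj_norm_valid K p.
  by apply: (allP vs); rewrite -has_pred1 has_count (leq_ltn_trans _ ltnp).
rewrite (bigID (pred1 p)) /=; apply: idealMr => //.
rewrite (eq_bigr (fun=> conj_norm K p)) => [|q /eqP-> //].
rewrite big_const_seq iter_mulr_1 -(subnK (ltnW ltnp)) exprD.
by apply: IM; apply: conj_norm_nilp.
Qed.
End PrincipalIdeal.

Lemma gen1_ideal H0 x0 : is_ideal (@gen1 gT T H0 x0).
Proof. exact: meet_ideal. Qed.

Lemma ipow_mono I J n : tsub I J -> tsub (ipow I n.+1) (ipow J n.+1).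
Proof.
move=> sIJ; elim: n => [|n IHn] //; apply: iprod_sub => [|H a b Ia Ib].
  exact: iprod_ideal.
by apply: mem_iprod; [apply: IHn | apply: sIJ].
Qed.

Lemma mem_ipow I H x n : I H x -> ipow I n.+1 H (x ^+ n.+1).
Proof.
move=> Ix; elim: n => [|n IHn]; first by rewrite expr1.
by rewrite exprSr; apply: mem_iprod.
Qed.

Lemma isqrtP I H x : is_ideal I ->
  isqrt I H x <-> exists n, I H (x ^+ n).
Proof.
move=> iI; split=> [[[|n] [// _ sI]]|[n Ix]].
  by exists n.+1; apply: sI; apply: mem_ipow => J.
by have [m sI] := ipow_gen1_nilp iI Ix; exists m.+1.
Qed.

Lemma isqrt_ideal I : is_ideal I -> is_ideal (isqrt I).
Proof.
move=> iI; have [I0 IM Ir In Ic] := ideal_absorbing iI.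
apply: is_idealP; split.
- by move=> H; apply/isqrtP => //; exists 1%N.
- move=> H x y /(isqrtP _ iI)[n Ix] /(isqrtP _ iI)[m Iy].
  apply/isqrtP => //; exists (n + m)%N; rewrite exprDn.
  apply: ideal_sum => // i; rewrite -mulrnAr.
  have [lem|gtm] := leqP m i.
    rewrite -mulr_natr -(subnK lem) exprD mulrA.
    by apply: idealMr => //; rewrite mulrA; apply: (IM).
  apply: idealMr => //.
  have : (n <= n + m - i)%N by rewrite -addnBA ?leq_addr // ltnW.
  by move/subnK=> <-; rewrite exprD; apply: IM.
- move=> H x y /(isqrtP _ iI)[n Iy]; apply/isqrtP => //; exists n.
  by rewrite exprMn; apply: IM.
- move=> H K x sKH /(isqrtP _ iI)[n Ix]; apply/isqrtP => //; exists n.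
  by rewrite -(ringhomX _ _ (rs_hom sKH)); apply: Ir.
- move=> H K x sKH [[|n] [// _ sI]]; exists n.+1; split=> // L z Gz.
  apply: sI; apply: ipow_mono Gz => {}L {}z Gz.
  apply: (Gz (gen1 K x)); first exact: gen1_ideal.
  by apply: (ideal_tf (gen1_ideal _) sKH) => J.
- move=> H K x sKH /(isqrtP _ iI)[n Ix]; apply/isqrtP => //; exists n.
  by rewrite -nmX //; apply: In.
- move=> g H K x eK /(isqrtP _ iI)[n Ix]; apply/isqrtP => //; exists n.
  by rewrite -(ringhomX _ _ (cj_hom eK)); apply: Ic.
Qed.

Lemma sub_isqrt I : is_ideal I -> tsub I (isqrt I).
Proof. by move=> iI H x Ix; apply/isqrtP => //; exists 1%N. Qed.

Lemma isqrt_radical I : is_ideal I -> is_radical (isqrt I).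
Proof.
move=> iI H x; split; first exact/sub_isqrt/isqrt_ideal.
move/(isqrtP _ (isqrt_ideal iI))=> [n /(isqrtP _ iI)[m Ix]].
by apply/isqrtP => //; exists (n * m)%N; rewrite exprM.
Qed.

Lemma radicalX I H x n : is_ideal I -> is_radical I -> I H (x ^+ n) -> I H x.
Proof. by move=> iI rI Ix; apply/rI/isqrtP => //; exists n. Qed.

Lemma prime_radical P : is_prime P -> is_radical P.
Proof.
case=> iP _ primeP H x; split; first exact: sub_isqrt.
case=> [[|n] [// _ sP]]; suff : tsub (gen1 H x) P by apply=> J.
elim: n sP => // n IHn /primeP[]//; [|exact: gen1_ideal].
by case: n {IHn}=> [|n]; [apply: gen1_ideal | apply: iprod_ideal].
Qed.

Lemma ideal_ext I J : teq I J -> is_ideal I -> is_ideal J.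
Proof.
move=> eIJ iI; have [I0 IM Ir In Ic] := ideal_absorbing iI.
apply: is_idealP; split; first by move=> H; apply/eIJ.
all: move=> *; apply/eIJ.
- by apply: idealD => //; apply/eIJ.
- by apply: IM; apply/eIJ.
- by apply: Ir => //; apply/eIJ.
- by apply: ideal_tf => //; apply/eIJ.
- by apply: In => //; apply/eIJ.
- by apply: Ic => //; apply/eIJ.
Qed.

Lemma isum_span (S : tpred T -> Prop) : (forall I, S I -> is_ideal I) ->
  teq (span (fun H x => x = 0 \/ exists2 I, S I & I H x)) (isum S).
Proof.
move=> iS H z; split.
  elim=> {H z} [H|H x y _ [n [I [a [SI Ia ->]]]] _ [m [J [b [SJ Jb ->]]]]|].
  - by exists 0%N, (fun _ _ => xpredT), (fun=> 0); split; [case | case | rewrite big_ord0].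
  - exists (n + m)%N.
    exists (fun i => match split i with inl k => I k | inr k => J k end).
    exists (fun i => match split i with inl k => a k | inr k => b k end).
    split=> [i|i|]; [by case: split | by case: split |].
    rewrite big_split_ord; congr (_ + _); apply: eq_bigr => i _.
      by rewrite (unsplitK (inl i)).
    by rewrite (unsplitK (inr i)).
  - move=> H K f sKH [->|[I SI If]].
      exists 0%N, (fun _ _ => xpredT), (fun=> 0).
      by split; [case | case | rewrite big_ord0 tf0].
    exists 1%N, (fun=> I), (fun=> tf H K f); split=> //; last by rewrite big_ord1.
    by move=> _; apply: ideal_tf sKH If; apply: iS.
case=> n [I [a [SI Ia ->]]]; apply: span_bigsum => i _.
by apply: sub_span; right; exists (I i).
Qed.

Lemma isum_ideal (S : tpred T -> Prop) :
  (forall I, S I -> is_ideal I) -> is_ideal (isum S).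
Proof.
move=> iS; apply: (ideal_ext (isum_span iS)); apply: span_ideal; split.
- by move=> H; left.
- move=> H x y [->|[I SI Iy]]; first by left; rewrite mulr0.
  by right; exists I => //; have [_ IM _ _ _] := ideal_absorbing (iS I SI); apply: IM.
- move=> H K x sKH [->|[I SI Ix]]; first by left; rewrite (ringhom0 (rs_hom sKH)).
  by right; exists I => //; have [_ _ Ir _ _] := ideal_absorbing (iS I SI); apply: Ir.
- move=> H K x sKH [->|[I SI Ix]]; first by left; rewrite nm0.
  by right; exists I => //; have [_ _ _ In _] := ideal_absorbing (iS I SI); apply: In.
- move=> g H K x eK [->|[I SI Ix]]; first by left; rewrite (ringhom0 (cj_hom eK)).
  by right; exists I => //; have [_ _ _ _ Ic] := ideal_absorbing (iS I SI); apply: Ic.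
Qed.

Lemma sub_isum (S : tpred T -> Prop) I : S I -> tsub I (isum S).
Proof.
move=> SI H x Ix; exists 1%N, (fun=> I), (fun=> x).
by rewrite big_ord1.
Qed.

Lemma isum_sub (S : tpred T -> Prop) P : is_ideal P ->
  (forall I, S I -> tsub I P) -> tsub (isum S) P.
Proof.
move=> iP sSP H _ [n [I [a [SI Ia ->]]]]; apply: ideal_sum => // i.
exact: sSP (Ia i).
Qed.

Lemma isqrt_sub I P : is_ideal I -> is_ideal P -> is_radical P ->
  tsub I P -> tsub (isqrt I) P.
Proof.
move=> iI iP rP sIP H x /(isqrtP _ iI)[n Ix].
by apply: (@radicalX _ _ _ n) => //; apply: sIP.
Qed.

Definition rad_ideal I (iI : is_ideal I) : radid T :=
  exist _ (isqrt I) (conj (isqrt_ideal iI) (isqrt_radical iI)).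

Definition point_prime (p : radid T -> bool) : tpred T :=
  isqrt (isum (fun I => exists2 K : radid T, ~ p K & I = sval K)).

Lemma isum_radid_ideal (S : radid T -> Prop) :
  is_ideal (isum (fun I => exists2 K : radid T, S K & I = sval K)).
Proof. by apply: isum_ideal => _ [K _ ->]; have [] := svalP K. Qed.

Lemma point_prime_ideal p : is_ideal (point_prime p).
Proof. exact/isqrt_ideal/isum_radid_ideal. Qed.

Lemma point_prime_radical p : is_radical (point_prime p).
Proof. exact/isqrt_radical/isum_radid_ideal. Qed.

Lemma point_mono p (I J : radid T) : is_point p ->
  tsub (sval I) (sval J) -> p I -> p J.
Proof.
case=> _ pM _ sIJ; rewrite (pM I J I) => [/andP[]//|H x].
by split=> [Ix|[]//]; split=> //; apply: sIJ.
Qed.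

Lemma pointE p (I : radid T) : is_point p ->
  p I <-> ~ tsub (sval I) (point_prime p).
Proof.
move=> pp; have [pU _ _] := pp.
pose Pp := rad_ideal (isum_radid_ideal (fun K : radid T => ~ p K)).
have notpP : ~ p Pp.
  have eP : teq (sval Pp) (point_prime p) by [].
  by case/(pU (fun K : radid T => ~ p K) _ eP).
split=> [pI sIP|nsIP]; first exact: notpP (point_mono pp (J := Pp) sIP pI).
apply: contrapT => npI; apply: nsIP => H x Ix.
by apply: sub_isqrt; [apply: isum_radid_ideal | apply: sub_isum Ix; exists I].
Qed.

Lemma ideal1 I : is_ideal I -> I [set: gT]%G 1 -> forall H x, I H x.
Proof.
move=> iI I1 H x; have [_ IM Ir _ _] := ideal_absorbing iI.
have := Ir _ _ _ (subsetT H) I1; have [_ _ ->] := rs_hom (subsetT H).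
by move=> IH1; rewrite -[x]mulr1; apply: IM.
Qed.

Lemma point_prime_is_prime p : is_point p -> is_prime (point_prime p).
Proof.
move=> pp; have iP := point_prime_ideal p; have rP := point_prime_radical p.
have [_ pM p1] := pp; split=> // [P1|I J iI iJ sIJP].
  have := p1 (rad_ideal iP); rewrite pointE //; apply=> // H x.
    by split=> // _; apply: sub_isqrt => //; apply: ideal1.
  exact: isqrt_sub.
have sP A (iA : is_ideal A) : ~ p (rad_ideal iA) -> tsub A (point_prime p).
  move=> npA H x Ax; apply: contrapT => nPx; apply: npA; rewrite pointE //.
  by move=> sAP; apply: nPx; apply: sAP; apply: sub_isqrt.
have [pI|/negP npI] := boolP (p (rad_ideal iI)); last by left; apply: sP npI.
have [pJ|/negP npJ] := boolP (p (rad_ideal iJ)); last by right; apply: sP npJ.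
have : p (rad_ideal (iprod_ideal I J)).
  rewrite (pM (rad_ideal iI) (rad_ideal iJ)) ?pI // => H x; split.
    move/(isqrtP _ (iprod_ideal I J))=> [n IJx].
    split; apply/isqrtP => //; exists n; move: IJx; apply: iprod_sub => // K a b.
      by move=> Ia _; apply: idealMr.
    by move=> _ Jb; have [_ JM _ _ _] := ideal_absorbing iJ; apply: JM.
  case=> /(isqrtP _ iI)[n Ix] /(isqrtP _ iJ)[m Jx].
  apply/isqrtP; first exact: iprod_ideal.
  by exists (n + m)%N; rewrite exprD; apply: mem_iprod.
by rewrite pointE // => nsP; case: nsP; apply: isqrt_sub => //; apply: iprod_ideal.
Qed.

Definition prime_point P : radid T -> bool := fun I : radid T => `[< ~ tsub (sval I) P >].

Lemma prime_pointE P (I : radid T) : prime_point P I <-> ~ tsub (sval I) P.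
Proof. by split=> [/asboolP|nIP]; last exact/asboolP. Qed.

Lemma prime_point_is_point P : is_prime P -> is_point (prime_point P).
Proof.
move=> primeP; have rP := prime_radical primeP; have [iP P1 PM] := primeP.
split.
- move=> S J eJ; rewrite prime_pointE.
  have iS := isum_radid_ideal S.
  split=> [nsJP|[K SK /prime_pointE nsKP] sJP]; last first.
    apply: nsKP => H x Kx; apply: sJP; apply/eJ; apply: sub_isqrt => //.
    by apply: sub_isum Kx; exists K.
  apply: contrapT => noK; apply: nsJP => H x /eJ; apply: isqrt_sub => //.
  apply: isum_sub => // _ [K SK ->]; apply: contrapT => nsKP; apply: noK.
  by exists K; rewrite ?prime_pointE.
- move=> I J K eK; apply/idP/andP=> [/prime_pointE nsKP|[]].
    by split; apply/prime_pointE => sP; apply: nsKP => H x /eK[Ix Jx]; apply: sP.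
  move=> /prime_pointE nsIP /prime_pointE nsJP; apply/prime_pointE => sKP.
  have [iI _] := svalP I; have [iJ _] := svalP J; have [iK _] := svalP K.
  have [|//|//] := PM _ _ iI iJ; apply: iprod_sub => // H a b Ia Jb.
  apply: sKP; apply/eK; split; first exact: idealMr.
  by have [_ JM _ _ _] := ideal_absorbing iJ; apply: JM.
- move=> K eK; apply/prime_pointE => sKP; apply: P1; apply: sKP.
  exact/eK.
Qed.

Definition point_spec (p : pt T) : spec T :=
  exist _ (point_prime (sval p)) (point_prime_is_prime (svalP p)).

Definition spec_point (P : spec T) : pt T :=
  exist _ (prime_point (sval P)) (prime_point_is_point (svalP P)).

Lemma point_specK : cancel point_spec spec_point.
Proof.
move=> p; apply: eq_sig_hprop => [*|]; first exact: Prop_irrelevance.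
 apply: funext => I /=.
by apply/idP/idP; rewrite prime_pointE -pointE //; apply: svalP.
Qed.

Lemma spec_pointK : cancel spec_point point_spec.
Proof.
move=> P; have primeP := svalP P; have rP := prime_radical primeP.
have [iP _ _] := primeP; have pP := prime_point_is_point primeP.
have iQ := point_prime_ideal (prime_point (sval P)).
have rQ := point_prime_radical (prime_point (sval P)).
have sub_eq I : is_ideal I -> is_radical I ->
    tsub I (sval P) <-> tsub I (point_prime (prime_point (sval P))).
  move=> iI rI; pose K : radid T := exist _ I (conj iI rI).
  have := pointE K pP; rewrite prime_pointE /= => eK.
  by split=> sI; apply: contrapT => /eK; apply.
apply: eq_sig_hprop => [*|]; first exact: Prop_irrelevance.
 apply: functional_extensionality_dep => H; apply: funext => x.
apply: propext; split=> [|Px]; first by apply: (iffRL (sub_eq _ iQ rQ)).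
by apply: (iffLR (sub_eq _ iP rP)).
Qed.

End TambaraIdeals.

Section Topology.
Context {X Y : Type}.

Lemma gen_open_topology (B : (X -> Prop) -> Prop) : is_topology (gen_open B).
Proof.
split=> [O tO _|U V oU oV O tO sBO|F oF O tO sBO]; have [OT OI OU] := tO => //.
  by apply: OI; [apply: oU | apply: oV].
by apply: OU => U FU; apply: oF.
Qed.

Lemma preimage_topology (OX : (X -> Prop) -> Prop) (f : X -> Y) :
  is_topology OX -> is_topology (fun U : Y -> Prop => OX (fun x => U (f x))).
Proof.
case=> OT OI OU; split=> // [U V|F oF]; first exact: OI.
have -> : (fun x => exists2 U, F U & U (f x)) =
    (fun x => exists2 V, (exists2 U, F U & V = fun x => U (f x)) & V x).
  apply: funext => x; apply: propext; split=> [[U FU Ufx]|[_ [U FU ->] Ufx]].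
    by exists (fun x => U (f x)) => //; exists U.
  by exists U.
by apply: OU => _ [U FU ->]; apply: oF.
Qed.

Lemma tcontinuous_gen (OX : (X -> Prop) -> Prop) (B : (Y -> Prop) -> Prop)
  (f : X -> Y) : is_topology OX ->
  (forall V, B V -> OX (fun x => V (f x))) -> tcontinuous OX (gen_open B) f.
Proof.
move=> tOX sB U oU; apply: (oU (fun V => OX (fun x => V (f x)))) => //.
exact: preimage_topology.
Qed.

End Topology.

Theorem theorem5p4 (gT : finGroupType) (T : tdata gT) (hT : is_tambara T) :
  exists (f : pt T -> spec T) (g : spec T -> pt T),
    [/\ cancel f g, cancel g f,
        tcontinuous (pt_open T) (spec_open T) f,
        tcontinuous (spec_open T) (pt_open T) g
      & forall (p : pt T) (I : radid T),
          sval p I = true <-> ~ tsub (sval I) (sval (f p))].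
Proof.
have fE (p : pt T) (I : radid T) :
    sval p I = true <-> ~ tsub (sval I) (sval (point_spec hT p)).
  by apply: pointE (svalP p).
exists (point_spec hT), (spec_point hT); split=> //.
- exact: point_specK.
- exact: spec_pointK.
- apply: tcontinuous_gen => [|_ [H [x ->]]]; first exact: gen_open_topology.
  move=> O _ BO; apply: BO; exists (rad_ideal hT (gen1_ideal hT x)).
  apply: funext => p; apply: propext; rewrite fE.
  have [iP _ _] := svalP (point_spec hT p).
  have rP := prime_radical hT (svalP (point_spec hT p)).
  split=> [nPx sP|nsP Px]; last first.
    apply: nsP; apply: isqrt_sub => //; first exact: gen1_ideal.
    by move=> K z /(_ _ iP Px).
  by apply: nPx; apply: sP; apply: sub_isqrt => [||J //]; rewrite //; apply: gen1_ideal.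
- apply: tcontinuous_gen => [|_ [I ->]]; first exact: gen_open_topology.
  have -> : (fun P : spec T => sval (spec_point hT P) I = true) =
      (fun P => exists2 U, (exists (H : {group gT}) (x : tR T H),
          sval I H x /\ U = fun P : spec T => ~ sval P H x) & U P).
    apply: funext => P; apply: propext.
    have -> : sval (spec_point hT P) I = true <-> ~ tsub (sval I) (sval P).
      exact: prime_pointE.
    split=> [nsIP|[_ [H [x [Ix ->]]] nPx sIP]]; last exact/nPx/sIP.
    apply: contrapT => noU; apply: nsIP => H x Ix; apply: contrapT => nPx.
    by apply: noU; exists (fun P : spec T => ~ sval P H x) => //; exists H, x.
  have [_ _ OU] := gen_open_topology (fun V : spec T -> Prop =>
    exists (H : {group gT}) (x : tR T H), V = fun P => ~ sval P H x).
  by apply: OU => _ [H [x [_ ->]]] O _ BO; apply: BO; exists H, x.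
Qed.
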